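(* For $n\ge1$ let $p(n)$ be the sum of $\mathrm{inter}(w)$ over all Catalan words $w$ of length $n$ avoiding the pattern $(\geq,\geq)$. Then \[ \sum_{n\ge1}p(n)x^n=\frac{\left(-8 x^{4}-8 x^{3}+5 x^{2}+3 x -1\right) \sqrt{1-2x-3x^{2}}-6 x^{6}-10 x^{5}+12 x^{4}+17 x^{3}-4 x^{2}-4 x +1}{6 x^{6}+4 x^{5}-2 x^{4}}, \] for all $n\ge1$ \[ p(n)=\frac{1}{2}\left(3^{n+1}+8T_n+8T_{n+1}-5T_{n+2}-3T_{n+3}+T_{n+4}\right), \] and $p(n)\sim 3^{n+1}/2$ as $n\to\infty$.
   Context: A Catalan word of length $n\ge 0$ is a sequence $w=w_1\cdots w_n$ of non-negative integers with $w_1=0$ and $0\le w_i\le w_{i-1}+1$ for $i=2,\dots,n$. It avoids the pattern $(\geq,\geq)$ if there is no index $i$ with $w_i\ge w_{i+1}\ge w_{i+2}$. To $w$ is associated the polyomino $P(w)$ with $n$ bottom-aligned columns, the $i$-th column consisting of $w_i+1$ unit cells. $\mathrm{inter}(w)$ is the number of lattice points belonging to exactly four cells of $P(w)$. $T_n=\sum_{k=0}^{n}\binom{n}{k}\binom{n-k}{k}$ is the central trinomial coefficient. *)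

(* Defs.v *)
From mathcomp Require Import all_boot.
Set Implicit Arguments.
Unset Strict Implicit.
Unset Printing Implicit Defensive.

Definition catalan_word (w : seq nat) : bool :=
  (head 0 w == 0) && sorted (fun a b => b <= a.+1) w.

Definition avoids_geq_geq (w : seq nat) : bool :=
  ~~ [exists i : 'I_(size w - 2),
        (nth 0 w i >= nth 0 w i.+1) && (nth 0 w i.+1 >= nth 0 w i.+2)].

(* The unit cell [i, i+1] x [j, j+1] is represented by its lower left corner
   (i, j); columns and rows are numbered from 0. *)
Definition polyomino (w : seq nat) : seq (nat * nat) :=
  [seq (i, j) | i <- iota 0 (size w), j <- iota 0 (nth 0 w i).+1].

(* A lattice point belongs to a closed unit cell iff it is one of its corners. *)
Definition corners (c : nat * nat) : seq (nat * nat) :=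
  [:: c; (c.1.+1, c.2); (c.1, c.2.+1); (c.1.+1, c.2.+1)].

Definition lattice_points (P : seq (nat * nat)) : seq (nat * nat) :=
  undup (flatten [seq corners c | c <- P]).

Definition inter (w : seq nat) : nat :=
  count (fun q => count (fun c => q \in corners c) (polyomino w) == 4)
        (lattice_points (polyomino w)).

(* The letters of a Catalan word of length n are smaller than n
   (lemma catalan_word_lt below), so words over 'I_n suffice. *)
Definition p (n : nat) : nat :=
  \sum_(w : n.-tuple 'I_n | catalan_word (map val w) &&
                            avoids_geq_geq (map val w)) inter (map val w).

Definition T (n : nat) : nat := \sum_(k < n.+1) 'C(n, k) * 'C(n - k, k).

Lemma catalan_word_lt (w : seq nat) : catalan_word w -> all (gtn (size w)) w.
Proof.
rewrite /catalan_word; case: w => [|a w] //= /andP[/eqP -> {a} pw].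
suff H : forall a m, a < m -> path (fun a b => b <= a.+1) a w ->
  all (gtn (m + size w)) w.
  by have := H 0 1 isT pw.
elim: w {pw} => //= b w IH a m am /andP[ba pw].
have bm : b < m.+1 by apply: leq_trans ba _.
rewrite -addSnnS; apply/andP; split; last exact: IH pw.
by apply: leq_trans bm _; rewrite leq_addr.
Qed.

(* Main.v *)
(* A word is built letter by letter, so the numbers of admissible continuations
   of a word ending in h, and their total weights, satisfy linear recurrences in
   the length; here inter(w) is the sum of min(w_i, w_{i+1}).  Read as formal
   power series, these are linear systems in h, with a unique solution because
   every occurrence of an unknown on the right carries a factor x.  With the
   parametrisation x = m / (1 + m + m^2) they are solved by rho^h, respectively
   by (quadratic in h) * rho^h plus (linear in h), where rho = m + 1 / (1 + m).
   The series of the T_n is (1 + m + m^2) / (1 - m^2), which follows from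
   (sum T_n x^n)^2 (1 - 2x - 3x^2) = 1, itself a consequence of the three-term
   recurrence for T_n; comparing the two gives the formula for p(n).
   The same identity shows sum_k T_k T_{n-k} <= 3^n, hence
   (n + 1) T_n^2 <= 9^n, so T_n is negligible with respect to 3^n, and it yields
   the value of the generating function for small x. *)

Require Import Defs.
From HB Require Import structures.
From mathcomp Require Import all_boot all_order all_algebra.
From mathcomp Require Import all_classical all_reals all_analysis.
From mathcomp Require Import ring lra zify.
Set Implicit Arguments.
Unset Strict Implicit.
Unset Printing Implicit Defensive.

Import Order.TTheory GRing.Theory Num.Theory.
Import numFieldNormedType.Exports.
Local Open Scope classical_set_scope.
Local Open Scope ring_scope.

(** * Formal power series *)

Definition fps (R : Type) : Type := nat -> R.

Section FormalPowerSeries.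
Variable R : comNzRingType.
Implicit Types (f g h u : fps R) (n N : nat).

HB.instance Definition _ := gen_eqMixin (fps R).
HB.instance Definition _ := gen_choiceMixin (fps R).

Definition fps_add f g : fps R := fun n => f n + g n.
Definition fps_opp f : fps R := fun n => - f n.
Definition fps_mul f g : fps R := fun n => \sum_(i < n.+1) f i * g (n - i)%N.
Definition fps_one : fps R := fun n => (n == 0)%:R.

Fact fps_addA : associative fps_add.
Proof. by move=> f g h; apply/funext => n; apply: addrA. Qed.

Fact fps_addC : commutative fps_add.
Proof. by move=> f g; apply/funext => n; apply: addrC. Qed.

Fact fps_add0 : left_id ((fun=> 0) : fps R) fps_add.
Proof. by move=> f; apply/funext => n; apply: add0r. Qed.

Fact fps_addN : left_inverse ((fun=> 0) : fps R) fps_opp fps_add.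
Proof. by move=> f; apply/funext => n; apply: addNr. Qed.

HB.instance Definition _ :=
  GRing.isZmodule.Build (fps R) fps_addA fps_addC fps_add0 fps_addN.

Definition trunc N f : {poly R} := \poly_(i < N) f i.

Lemma fps_mul_trunc N f g n : (n < N)%N ->
  fps_mul f g n = (trunc N f * trunc N g)`_n.
Proof.
move=> nN; rewrite coefM; apply: eq_bigr => i _.
rewrite !coef_poly (leq_ltn_trans _ nN) ?(leq_ltn_trans (leq_subr _ _) nN) //.
by rewrite -ltnS.
Qed.

Fact fps_mulC : commutative fps_mul.
Proof.
by move=> f g; apply/funext => n; rewrite !(fps_mul_trunc _ _ (ltnSn n)) mulrC.
Qed.

Fact fps_mulA : associative fps_mul.
Proof.
move=> f g h; apply/funext => n.
pose t := trunc n.+1.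
transitivity ((t f * t g * t h)`_n).
  rewrite -mulrA coefM; apply: eq_bigr => i _.
  by rewrite coef_poly ltn_ord (fps_mul_trunc (N := n.+1)) // ltnS leq_subr.
rewrite coefM; apply: eq_bigr => i _.
by rewrite coef_poly ltnS leq_subr (fps_mul_trunc (N := n.+1)).
Qed.

Fact fps_mul1 : left_id fps_one fps_mul.
Proof.
move=> f; apply/funext => n.
rewrite /fps_mul big_ord_recl /= big1 ?addr0 ?mul1r ?subn0 // => i _.
by rewrite mul0r.
Qed.

Fact fps_mulDl : left_distributive fps_mul fps_add.
Proof.
move=> f g h; apply/funext => n; rewrite /fps_mul /fps_add -big_split /=.
by apply: eq_bigr => i _; rewrite mulrDl.
Qed.

Fact fps_oner_neq0 : fps_one != 0.
Proof. by apply/eqP => /(congr1 (@^~ 0)) /eqP; rewrite oner_eq0. Qed.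

HB.instance Definition _ := GRing.Zmodule_isComNzRing.Build (fps R)
  fps_mulA fps_mulC fps_mul1 fps_mulDl fps_oner_neq0.

Lemma fpsD f g n : (f + g) n = f n + g n. Proof. by []. Qed.
Lemma fpsN f n : (- f) n = - f n. Proof. by []. Qed.
Lemma fpsM f g n : (f * g) n = \sum_(i < n.+1) f i * g (n - i)%N.
Proof. by []. Qed.
Lemma fps1 n : (1 : fps R) n = (n == 0)%:R. Proof. by []. Qed.

Lemma fpsMn f k n : (f *+ k) n = f n *+ k.
Proof. by elim: k => // k IH; rewrite !mulrS fpsD IH. Qed.

Lemma fps_natM k f n : (k%:R * f) n = f n *+ k.
Proof. by rewrite -fpsMn mulr_natl. Qed.

Lemma fps_sum (I : Type) (r : seq I) (P : pred I) (F : I -> fps R) n :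
  (\sum_(i <- r | P i) F i) n = \sum_(i <- r | P i) F i n.
Proof. by elim/big_rec2: _ => // i y z _ <-. Qed.

Lemma fpsM0 f g : (f * g) 0%N = f 0%N * g 0%N.
Proof. by rewrite fpsM big_ord1. Qed.

Definition fpsX : fps R := fun n => (n == 1)%:R.

Lemma fpsXM0 f : (fpsX * f) 0%N = 0.
Proof. by rewrite fpsM0 mul0r. Qed.

Lemma fpsXMS f n : (fpsX * f) n.+1 = f n.
Proof.
rewrite fpsM !big_ord_recl /= mul0r add0r mul1r subSS subn0 big1 ?addr0 // => i _.
by rewrite mul0r.
Qed.

Lemma fpsXnM k f n : (fpsX ^+ k * f) (k + n)%N = f n.
Proof. by elim: k => [|k IH]; rewrite ?expr0 ?mul1r // exprS -mulrA fpsXMS. Qed.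

Lemma fpsX_inj f g : fpsX * f = fpsX * g -> f = g.
Proof. by move=> fg; apply/funext => n; rewrite -(fpsXMS f) fg fpsXMS. Qed.

Lemma fpsXn_inj k f g : fpsX ^+ k * f = fpsX ^+ k * g -> f = g.
Proof. by move=> fg; apply/funext => n; rewrite -(fpsXnM k f) fg fpsXnM. Qed.

Lemma fps_shift f : f 0%N = 0 -> f = fpsX * (fun n => f n.+1).
Proof. by move=> f0; apply/funext => -[|n]; rewrite ?fpsXM0 ?fpsXMS. Qed.

Lemma fps_lregP u f : u 0%N = 1 -> u * f = 0 -> f = 0.
Proof.
move=> u0 uf; apply/funext => n; elim/ltn_ind: n => n IH.
have : (u * f) n = 0 by rewrite uf.
rewrite fpsM big_ord_recl u0 mul1r subn0.
rewrite big1 ?addr0 // => i _; rewrite (IH (n - _)%N) ?mulr0 //.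
by rewrite lift0; have := ltn_ord i; lia.
Qed.

Lemma fps_lreg u f g : u 0%N = 1 -> u * f = u * g -> f = g.
Proof.
move=> u0 fg; apply: subr0_eq; apply: (fps_lregP u0).
by rewrite mulrBr fg subrr.
Qed.

(* The Euler operator x d/dx. *)
Definition euler f : fps R := fun n => n%:R * f n.

Lemma eulerD f g : euler (f + g) = euler f + euler g.
Proof. by apply/funext => n; rewrite /euler !fpsD mulrDr. Qed.

Lemma eulerM f g : euler (f * g) = euler f * g + f * euler g.
Proof.
apply/funext => n; rewrite fpsD !fpsM /euler -big_split mulr_sumr /=.
apply: eq_bigr => i _.
have -> : n%:R = (i : nat)%:R + (n - i)%:R :> R by rewrite -natrD subnKC // -ltnS.
by rewrite mulrDl mulrA mulrCA.
Qed.

Definition fps_geom (a : R) : fps R := fun n => a ^+ n.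

Lemma fps_geomP (a : R) : fps_geom a = 1 + fpsX * (fun n => a * fps_geom a n).
Proof.
by apply/funext => -[|n]; rewrite fpsD fps1 ?fpsXM0 ?fpsXMS ?addr0 ?add0r ?expr0 // -exprS.
Qed.

End FormalPowerSeries.
Arguments fpsX {R}.

(** * Central trinomial coefficients *)

Section CentralTrinomial.
Let Q : {poly int} := (1 + 'X) + 'X^2.

Lemma coef_Xadd1n (k j : nat) : ((1 + 'X : {poly int}) ^+ k)`_j = 'C(k, j)%:R.
Proof.
rewrite exprDn coef_sum.
under eq_bigr => i _ do rewrite expr1n mul1r coefMn coefXn.
have [jk|kj] := ltnP j k.+1.
  rewrite (bigD1 (Ordinal jk)) //= eqxx big1 ?addr0 // => i ij.
  by rewrite [j == _]eq_sym (negPf (ij : val i != j)) mul0rn.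
rewrite bin_small // big1 // => i _.
by rewrite (_ : (j == i) = false) ?mul0rn //; have := ltn_ord i; lia.
Qed.

Lemma T_coef (n : nat) : (T n)%:R = (Q ^+ n)`_n.
Proof.
rewrite /Q exprDn coef_sum /T natr_sum; apply: eq_bigr => i _.
rewrite coefMn -exprM coefMXn coef_Xadd1n natrM mulrC mulr_natr; congr (_ *+ _).
have := ltn_ord i; rewrite ltnS => i_n.
have [ni|ni] := ltnP n (2 * i); first by rewrite bin_small //; lia.
by rewrite (_ : n - 2 * i = n - i - i)%N ?bin_sub //; lia.
Qed.

Lemma deriv_trinomX (n j : nat) :
  (Q ^+ n.+1)`_j.+1 *+ j.+1 =
    ((Q ^+ n)`_j + (if j is k.+1 then (Q ^+ n)`_k else 0) *+ 2) *+ n.+1.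
Proof.
rewrite -coef_deriv deriv_exp /= coefMn; congr (_ *+ _).
rewrite {1}/Q !derivD -polyC1 derivC derivX derivXn expr1 add0r.
rewrite mulrC mulrDr mulr1 coefD mulrnAr coefMn coefMX.
by case: j.
Qed.

Lemma trinomX_rec (n j : nat) :
  (Q ^+ n.+1)`_j.+1 =
    (Q ^+ n)`_j.+1 + (Q ^+ n)`_j + (if j is k.+1 then (Q ^+ n)`_k else 0).
Proof.
rewrite exprSr {2}/Q !mulrDr mulr1 !coefD coefMX coefMXn.
by case: j => [|j] //=; rewrite subSS subSS subn0.
Qed.

Lemma T_recurrence (n : nat) :
  (n.+2 * T n.+2 = (2 * n + 3) * T n.+1 + 3 * n.+1 * T n)%N.
Proof.
pose b k := (Q ^+ k)`_k.+1.
have TS k : (T k.+1)%:R = (T k)%:R + b k *+ 2 :> int.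
  have := trinomX_rec k k; have := deriv_trinomX k k.
  rewrite -!T_coef -/(b k); set c := (if k is _.+1 then _ else _) => H1 H2.
  have {}H1 : (T k.+1)%:R = (T k)%:R + c *+ 2 :> int.
    by apply: (mulIf (x := k.+1%:R)); rewrite ?pnatr_eq0 // !mulr_natr.
  by move: H1; rewrite {}H2; lia.
have bS k : b k.+1 *+ k.+2 = (b k + (T k)%:R *+ 2) *+ k.+1.
  by have := deriv_trinomX k k.+1; rewrite -T_coef.
apply/eqP; rewrite -(eqr_nat int) natrD !natrM natrD natrM; apply/eqP.
have := bS n; rewrite (TS n.+1) -[b n.+1 *+ _]mulr_natl -[X in _ = X]mulr_natl => Hb.
rewrite mulrDr [n.+2%:R * (b n.+1 *+ 2)]mulrnAr Hb TS.
by rewrite -(natr1 n.+1) -(natr1 n); ring.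
Qed.

End CentralTrinomial.

Lemma T0 : T 0 = 1%N. Proof. by rewrite /T big_ord1. Qed.
Lemma T1 : T 1 = 1%N. Proof. by rewrite /T !big_ord_recl big_ord0. Qed.

(* Two-sided bound on the ratio: each half of the conjunction at n gives the
   other half at n+1 through the recurrence. *)
Lemma T_ratio (n : nat) :
  (T n.+1 <= 3 * T n /\ 3 * n.+1 * T n <= (n + 3) * T n.+1)%N.
Proof.
elim: n => [|n [IH1 IH2]]; first by rewrite T0 T1.
have E := T_recurrence n; split; nia.
Qed.

Section TrinomialSeries.
Variable R : numDomainType.

Definition T_series : fps R := fun n => (T n)%:R.

Lemma euler_T_series : euler T_series =
  fpsX * (2 * euler T_series + T_series) + 3 * fpsX ^+ 2 * (euler T_series + T_series).
Proof.
rewrite expr2 [3 * _]mulrC -!mulrA -mulrDr.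
apply/funext => -[|n]; first by rewrite fpsXM0 /euler mul0r.
rewrite fpsXMS !fpsD. rewrite fps_natM.
case: n => [|n]; first by rewrite fpsXM0 /euler /T_series T0 T1 mul0r mul0rn mulr1 add0r addr0.
have E : n.+2%:R * (T n.+2)%:R =
    (2 * n%:R + 3) * (T n.+1)%:R + 3 * (n%:R + 1) * (T n)%:R :> R.
  by rewrite -natrM T_recurrence natrD !natrM natrD natrM -(natr1 n).
rewrite fpsXMS fps_natM fpsD /euler /T_series [LHS]E -(natr1 n).
by ring.
Qed.

Lemma euler1 : euler (1 : fps R) = 0.
Proof. by apply/funext => -[|n]; rewrite /euler ?mul0r // fps1 mulr0. Qed.

Lemma eulerX : euler (fpsX : fps R) = fpsX.
Proof. by apply/funext => -[|[|n]]; rewrite /euler /fpsX ?mul0r ?mulr1 ?mulr0. Qed.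

Lemma T_series_sqr : T_series ^+ 2 * (1 - 2 * fpsX - 3 * fpsX ^+ 2) = 1.
Proof.
set D := 1 - _ - _; set t := T_series.
have eD : D = 1 - fpsX - fpsX - (fpsX + fpsX + fpsX) * fpsX by rewrite /D; ring.
have eN (f : fps R) : euler (- f) = - euler f.
  by apply/funext => n; rewrite /euler !fpsN mulrN.
have euD : euler D = - (2 * fpsX + 6 * fpsX ^+ 2).
  by rewrite eD !(eulerD, eN, eulerM, eulerX, euler1); ring.
have eut : D * euler t = (fpsX + 3 * fpsX ^+ 2) * t.
  by have := euler_T_series; rewrite -/t => E; rewrite /D mulrBl mulrBl mul1r {1}E; ring.
have E0 : euler (t ^+ 2 * D) = 0.
  rewrite expr2 !eulerM euD.
  transitivity (2 * t * (D * euler t) - t ^+ 2 * (2 * fpsX + 6 * fpsX ^+ 2)); first by ring.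
  by rewrite eut; ring.
apply/funext => -[|n].
  have D0 : D 0%N = 1.
    rewrite eD !fpsD !fpsN !fpsM0 !fpsD fps1 /fpsX /=.
    by rewrite !addr0 mulr0 !subr0.
  by rewrite fpsM0 expr2 fpsM0 D0 /t /T_series T0 !mulr1.
have : euler (t ^+ 2 * D) n.+1 = 0 by rewrite E0.
by rewrite /euler => /eqP; rewrite mulf_eq0 pnatr_eq0 /= => /eqP ->.
Qed.

End TrinomialSeries.

(** * Continuations of words *)

Section Words.
Local Open Scope nat_scope.
Implicit Types (w s : seq nat) (n h b : nat) (up : bool).

(* The continuations of a word ending in the letter h; [up] says that the
   last step was an ascent (or that h is the first letter), so that a weak
   descent is allowed next. *)
Fixpoint continuation h up s : bool :=
  if s is b :: s' then
    [&& b <= h.+1, (b <= h) ==> up & continuation b (h < b) s']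
  else true.

Fixpoint continuations n h up : seq (seq nat) :=
  if n is n'.+1 then
    [seq b :: s | b <- [seq b <- iota 0 h.+2 | (b <= h) ==> up],
                  s <- continuations n' b (h < b)]
  else [:: [::]].

Fixpoint adjacent_min h s : nat :=
  if s is b :: s' then minn h b + adjacent_min b s' else 0.

Lemma mem_continuations n h up s :
  (s \in continuations n h up) = (size s == n) && continuation h up s.
Proof.
elim: n h up s => [|n IH] h up s; first by rewrite inE; case: s.
apply/allpairsPdep/idP => [[b [s' [bin s'in ->]]]|].
  move: bin s'in; rewrite mem_filter mem_iota add0n ltnS IH /= => /andP[-> ->].
  by rewrite eqSS => /andP[-> ->].
case: s => // b s; rewrite [continuation _ _ _]/= => /andP[sn /and3P[bh bup cs]].
exists b, s; split => //; first by rewrite mem_filter bup mem_iota add0n ltnS bh.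
by rewrite IH -eqSS sn cs.
Qed.

Lemma continuations_uniq n h up : uniq (continuations n h up).
Proof.
elim: n h up => // n IH h up; apply: allpairs_uniq_dep => //.
- by rewrite filter_uniq // iota_uniq.
- by move=> [b s] [b' s'] _ _ /= [-> ->].
Qed.

Lemma big_continuationsS (V : nmodType) n h up (F : seq nat -> V) :
  (\sum_(s <- continuations n.+1 h up) F s =
    \sum_(s <- continuations n h.+1 true) F (h.+1 :: s) +
    (if up then \sum_(b < h.+1) \sum_(s <- continuations n b false) F ((b : nat) :: s)
     else 0))%R.
Proof.
rewrite -[continuations n.+1 h up]/[seq b :: s |
  b <- [seq b <- iota 0 h.+2 | (b <= h) ==> up], s <- continuations n b (h < b)].
rewrite big_allpairs_dep big_filter.
have -> : iota 0 h.+2 = index_iota 0 h.+1 ++ [:: h.+1].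
  by rewrite /index_iota subn0 -[h.+2]addn1 iotaD.
rewrite big_cat /= addrC big_cons big_nil ltnn /= addr0 ltnS leqnn big_mkord.
congr (_ + _)%R.
case: up => /=; last by rewrite big_pred0 // => i; rewrite -ltnS ltn_ord.
apply: eq_big => [i|i _]; first by rewrite implybT.
by rewrite ltnNge -ltnS ltn_ord.
Qed.

Lemma avoids_cons3 a b c s : avoids_geq_geq [:: a, b, c & s] =
  ~~ ((b <= a) && (c <= b)) && avoids_geq_geq [:: b, c & s].
Proof.
rewrite /avoids_geq_geq -negb_or; congr (~~ _).
apply/existsP/orP => [[[[|i] Hi]] /= Hw|[Hw|/existsP[[i Hi] /= Hw]]].
- by left.
- have Hi' : i < size [:: b, c & s] - 2 by move: Hi => /=; lia.
  by right; apply/existsP; exists (Ordinal Hi').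
- by exists (Ordinal (isT : 0 < size [:: a, b, c & s] - 2)).
- have Hi' : i.+1 < size [:: a, b, c & s] - 2 by move: Hi => /=; lia.
  by exists (Ordinal Hi').
Qed.

Lemma catalan_avoidsE a s :
  catalan_word (a :: s) && avoids_geq_geq (a :: s) =
  (a == 0) && continuation a true s.
Proof.
rewrite /catalan_word /= -andbA; congr (_ && _).
case: s => [|b s] /=.
  by rewrite /avoids_geq_geq; apply/existsP => -[[]].
rewrite implybT /= -andbA; congr (_ && _).
elim: s a b => [|c s IH] a b /=.
  by rewrite /avoids_geq_geq; apply/existsP => -[[]].
rewrite avoids_cons3 -IH -!andbA; congr (_ && _).
by rewrite andbCA; congr (_ && _); rewrite negb_and -!ltnNge implybE -ltnNge orbC.
Qed.

Lemma adjacent_minE h s :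
  adjacent_min h s =
  \sum_(i < size s) minn (nth 0 (h :: s) i) (nth 0 (h :: s) i.+1).
Proof.
elim: s h => [|b s IH] h /=; first by rewrite big_ord0.
by rewrite big_ord_recl /= IH.
Qed.

Lemma mem_polyomino w (c : nat * nat) :
  (c \in polyomino w) = (c.1 < size w) && (c.2 <= nth 0 w c.1).
Proof.
apply/allpairsPdep/andP => [[i [j [+ + ->]]]|[c1 c2]].
  by rewrite !mem_iota !add0n ltnS.
by exists c.1, c.2; rewrite !mem_iota !add0n ltnS; case: c c1 c2.
Qed.

Lemma polyomino_uniq w : uniq (polyomino w).
Proof.
apply: allpairs_uniq_dep => [|i _|]; rewrite ?iota_uniq //.
by move=> [i j] [i' j'] _ _ /= [-> ->].
Qed.

Lemma four_cellsE w (x y : nat) :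
  (count (fun c => (x, y) \in corners c) (polyomino w) == 4) =
  [&& 0 < x, 0 < y, x < size w & y <= minn (nth 0 w x.-1) (nth 0 w x)].
Proof.
pose B := [seq c <- [:: (x, y); (x.-1, y); (x, y.-1); (x.-1, y.-1)]
          | (x, y) \in corners c].
have BE c : ((x, y) \in corners c) -> c \in [:: (x, y); (x.-1, y); (x, y.-1); (x.-1, y.-1)].
  case: c => i j; rewrite !inE !xpair_eqE /=; lia.
rewrite -size_filter.
set A := [seq c <- _ | _].
have uA : uniq A by rewrite filter_uniq // polyomino_uniq.
set L := [:: _; _; _; _] in B BE.
have AL : {subset A <= L} by move=> c; rewrite mem_filter => /andP[/BE].
apply/eqP/idP => [A4|/and4P[x0 y0 xw yw]].
  have [uL LA] : uniq L /\ A =i L.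
    have le : size L <= size A by rewrite A4.
    have [_ eqAL] := uniq_min_size uA AL le.
    by split; [rewrite -(eq_uniq _ eqAL) // A4|].
  have x0 : 0 < x by move: uL; rewrite /L /= !inE !xpair_eqE; lia.
  have y0 : 0 < y by move: uL; rewrite /L /= !inE !xpair_eqE; lia.
  have : (x, y) \in A by rewrite LA !inE eqxx.
  have : (x.-1, y) \in A by rewrite LA !inE eqxx orbT.
  rewrite !mem_filter !mem_polyomino /= => /and3P[_ _ ?] /and3P[_ ? ?].
  by rewrite x0 y0 leq_min /=; apply/and3P.
have uL : uniq L by rewrite /L /= !inE !xpair_eqE; lia.
suff /perm_size -> : perm_eq A L by [].
apply: uniq_perm => // c; apply/idP/idP => [/AL //|].
move: yw; rewrite leq_min => /andP[yw1 yw2].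
rewrite mem_filter mem_polyomino /L !inE => /or4P[] /eqP -> /=;
  rewrite !xpair_eqE; apply/and3P; split => //; lia.
Qed.

Lemma inter_cons h s : inter (h :: s) = adjacent_min h s.
Proof.
rewrite /inter -size_filter; set A := [seq q <- _ | _]; set w := h :: s.
pose L := [seq (i.+1, j.+1) | i <- iota 0 (size s),
                              j <- iota 0 (minn (nth 0 w i) (nth 0 w i.+1))].
have uL : uniq L.
  apply: allpairs_uniq_dep => [|i _|]; rewrite ?iota_uniq //.
  by move=> [i j] [i' j'] _ _ /= [-> ->].
have uA : uniq A by rewrite filter_uniq // undup_uniq.
have -> : size A = size L.
  apply/perm_size/uniq_perm => // -[x y]; rewrite mem_filter four_cellsE.
  apply/andP/allpairsPdep => [[/and4P[x0 y0 xs ym] _]|[i [j [+ + [-> ->]]]]].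
    exists x.-1, y.-1; rewrite !mem_iota !add0n !prednK //; split => //.

  rewrite !mem_iota !add0n => Hi Hj; split; first by apply/and4P.
  rewrite mem_undup; apply/flatten_mapP; exists (i, j); last first.
    by rewrite !inE eqxx !orbT.
  rewrite mem_polyomino /=; move: Hi Hj; rewrite leq0n /= leq_min => Hi /andP[/ltnW -> _].
  by rewrite andbT ltnS ltnW.
rewrite size_allpairs_dep sumnE big_map.
rewrite (_ : iota 0 (size s) = index_iota 0 (size s)); last first.
  by rewrite /index_iota subn0.
rewrite big_mkord adjacent_minE.
by apply: eq_bigr => i _; rewrite size_iota.
Qed.

Lemma p_continuations n :
  p n.+1 = \sum_(s <- continuations n 0 true) adjacent_min 0 s.
Proof.
pose letters (t : n.+1.-tuple 'I_n.+1) := map val t.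
pose P t := catalan_word (letters t) && avoids_geq_geq (letters t).
transitivity (\sum_(w <- [seq letters t | t <- [seq t <- index_enum _ | P t]]) inter w).
  by rewrite big_map big_filter.
transitivity (\sum_(w <- [seq 0 :: s | s <- continuations n 0 true]) inter w).
  apply: perm_big; apply: uniq_perm.
  - rewrite map_inj_uniq ?filter_uniq ?index_enum_uniq //.
    by move=> t u tu; apply/val_inj/(inj_map val_inj).
  - by rewrite map_inj_uniq ?continuations_uniq // => s s' [].
  move=> w; apply/mapP/mapP => [[t]|[s]].
    rewrite mem_filter => /andP[+ _] ->.
    case: t => -[//|a t] /= size_t; rewrite /P /letters /= catalan_avoidsE.
    move=> /andP[/eqP a0 ct].
    exists (map val t); last by rewrite a0.
    rewrite mem_continuations size_map -eqSS size_t.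
    by rewrite -[X in continuation X]a0.
  rewrite mem_continuations => /andP[sn cs] ->.
  have cw : catalan_word (0 :: s) && avoids_geq_geq (0 :: s).
    by rewrite catalan_avoidsE eqxx.
  have lt_w : all (gtn n.+1) (0 :: s).
    have /andP[/catalan_word_lt + _] := cw.
    by rewrite /= (eqP sn).
  pose t := map (@inord n) (0 :: s).
  have st : size t == n.+1 by rewrite size_map /= eqSS.
  have vt : map val t = 0 :: s.
    rewrite -map_comp -[RHS]map_id; apply/eq_in_map => i i_w /=.
    by rewrite inordK //; apply: (allP lt_w).
  have lt : letters (Tuple st) = 0 :: s by [].
  by exists (Tuple st); rewrite ?lt // mem_filter /P lt cw mem_index_enum.
by rewrite big_map; apply: eq_bigr => s _; rewrite inter_cons.
Qed.

Definition count_cont n h up : nat := size (continuations n h up).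

Definition weight_cont n h up : nat :=
  \sum_(s <- continuations n h up) adjacent_min h s.

Lemma count_contS n h up : count_cont n.+1 h up =
  count_cont n h.+1 true + (if up then \sum_(b < h.+1) count_cont n b false else 0).
Proof.
have E m k u : count_cont m k u = \sum_(s <- continuations m k u) 1.
  by rewrite /count_cont -sum1_size.
rewrite !E (big_continuationsS n h up (fun=> 1)); congr (_ + _).
by case: up => //; apply: eq_bigr => b _; rewrite E.
Qed.

Lemma weight_contS n h up : weight_cont n.+1 h up =
  weight_cont n h.+1 true + h * count_cont n h.+1 true +
  (if up then \sum_(b < h.+1) (weight_cont n b false + b * count_cont n b false)
   else 0).
Proof.
have E (m a b : nat) u : \sum_(s <- continuations m b u) adjacent_min a (b :: s) =
    weight_cont m b u + minn a b * count_cont m b u.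
  rewrite /= big_split /= addnC /count_cont -sum1_size big_distrr /=.
  by congr (_ + _); apply: eq_bigr => s _; rewrite muln1.
rewrite {1}/weight_cont (big_continuationsS n h up (adjacent_min h)) E.
rewrite (minn_idPl (leqnSn h)); congr (_ + _).
case: up => //; apply: eq_bigr => b _; rewrite E.
by rewrite (minn_idPr _) // -ltnS.
Qed.

End Words.

(** * Generating functions *)

Section GeneratingFunctions.
Variable R : numFieldType.
Local Notation x := (fpsX : fps R).

Lemma fps_natI (k : nat) (f g : fps R) : k.+1%:R * f = k.+1%:R * g -> f = g.
Proof.
move=> fg; apply/funext => n; apply: (@mulfI _ k.+1%:R); rewrite ?pnatr_eq0 //.
by rewrite !mulr_natl -!fps_natM fg.
Qed.

(* The parametrisation x = m / (1 + m + m^2); m / x is the Motzkin series. *)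
Lemma trinomial_parametrisation : exists m u i : fps R,
  [/\ x = m * u, u * (1 + m + m ^+ 2) = 1, i * (1 + m) = 1
    & T_series R * u * (1 - m ^+ 2) = 1 /\ m 0%N = 0].
Proof.
set t := T_series R; have tD := T_series_sqr R; rewrite -/t in tD.
set D : fps R := 1 - _ - _ in tD; pose s : fps R := D * t.
have s0 : t 0%N = 1 by rewrite /t /T_series T0.
have sE : s = t - x * (2 * t + 3 * (x * t)) by rewrite /s /D; ring.
pose mu : fps R := fun n => (1 - x - s) n / 2.
have muE : 2 * mu = 1 - x - s.
  by apply/funext => n; rewrite fps_natM -[LHS]mulr_natr /mu divfK ?pnatr_eq0.
pose m : fps R := fun n => mu n.+1.
have xm : x * m = mu.
  rewrite -fps_shift // /mu sE !fpsD !fpsN. rewrite fpsD fpsN fpsXM0 fps1 /fpsX s0.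
  by rewrite /= !subr0 subrr mul0r.
have sm : s = 1 - x - 2 * x * m by rewrite -mulrA xm muE; ring.
have ss : s ^+ 2 = D.
  transitivity (D * (t ^+ 2 * D)); first by rewrite /s; ring.
  by rewrite tD mulr1.
have mx : m = x * (1 + m + m ^+ 2).
  apply: fpsX_inj; apply: (@fps_natI 3); apply: subr0_eq.
  transitivity (D - s ^+ 2); last by rewrite ss subrr.
  by rewrite sm /D; ring.
have m0 : m 0%N = 0 by rewrite mx fpsXM0.
pose u := 1 - x * (1 + m).
have ue : u * (1 + m + m ^+ 2) = 1.
  transitivity (1 + m + m ^+ 2 - x * (1 + m + m ^+ 2) * (1 + m)).
    by rewrite /u; ring.
  by rewrite -mx; ring.
have xmu : x = m * u by rewrite mx -mulrA [_ * u]mulrC ue mulr1.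
pose g := fps_geom (- 1 : R).
have gE : g * (1 + x) = 1.
  have E := fps_geomP (- 1 : R); rewrite -/g in E.
  have Ng : (fun n => - 1 * g n) = - g :> fps R.
    by apply/funext => n; rewrite fpsN mulN1r.
  by rewrite Ng in E; rewrite mulrDr mulr1 {1}E; ring.
exists m, u, (u * (g * (1 + m))); split => //; last split => //.
  transitivity (g * (u * (1 + m + m ^+ 2) + m * u)); first by ring.
  by rewrite ue -xmu.
have u0 : u 0%N = 1 by rewrite /u fpsD fpsN fpsXM0 fps1 subr0.
apply: (@fps_lreg _ (u * (1 - m ^+ 2))).
  by rewrite fpsM0 u0 fpsD fpsN expr2 fpsM0 m0 mulr0 fps1 subr0 mulr1.
transitivity (t * (u * (1 - m ^+ 2)) ^+ 2); first by ring.
suff -> : u * (1 - m ^+ 2) = s by rewrite ss mulr1 mulrC.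
rewrite sm {1}xmu.
transitivity (u * (1 + m + m ^+ 2) - m * u - 2 * (m * u) * m); first by ring.
by rewrite ue -xmu.
Qed.

Lemma fps_homogeneous_eq0 (d : nat -> fps R) :
  (forall h : nat, d h = x * d h.+1 + x * \sum_(b < h.+1) x * d b.+1) ->
  forall h : nat, d h = 0.
Proof.
move=> dE h; apply/funext => n; elim/ltn_ind: n h => n IH h.
rewrite dE fpsD; case: n IH => [|n] IH; first by rewrite !fpsXM0 addr0.
rewrite !fpsXMS IH // add0r fps_sum big1 // => b _.
case: n IH => [|n] IH; first by rewrite fpsXM0.
by rewrite fpsXMS IH.
Qed.

Definition count_series h up : fps R := fun n => (count_cont n h up)%:R.
Definition weight_series h up : fps R := fun n => (weight_cont n h up)%:R.

Lemma count_series_down h :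
  count_series h false = 1 + x * count_series h.+1 true.
Proof.
apply/funext => -[|n]; rewrite fpsD fps1 ?fpsXM0 ?fpsXMS ?addr0 ?add0r //.
by rewrite /count_series count_contS addn0.
Qed.

Lemma count_series_up h : count_series h true =
  1 + x * count_series h.+1 true + x * \sum_(b < h.+1) count_series b false.
Proof.
apply/funext => -[|n]; rewrite !fpsD fps1 ?fpsXM0 ?fpsXMS ?addr0 ?add0r //.
by rewrite /count_series count_contS natrD natr_sum fps_sum.
Qed.

Lemma weight_cont0 h up : weight_cont 0 h up = 0%N.
Proof. by rewrite /weight_cont big_seq1. Qed.

Lemma weight_series_down h : weight_series h false =
  x * (weight_series h.+1 true + h%:R * count_series h.+1 true).
Proof.
apply/funext => -[|n]; rewrite ?fpsXM0 ?fpsXMS /weight_series ?weight_cont0 //.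
by rewrite weight_contS fpsD fps_natM addn0 natrD natrM mulr_natl.
Qed.

Lemma weight_series_up h : weight_series h true =
  x * (weight_series h.+1 true + h%:R * count_series h.+1 true) +
  x * \sum_(b < h.+1) (weight_series b false + b%:R * count_series b false).
Proof.
apply/funext => -[|n]; rewrite fpsD ?fpsXM0 ?fpsXMS /weight_series ?weight_cont0 ?addr0 //.
rewrite weight_contS fpsD fps_natM fps_sum !natrD natrM mulr_natl; congr (_ + _).
by rewrite natr_sum; apply: eq_bigr => b _; rewrite fpsD fps_natM natrD natrM mulr_natl.
Qed.

Section Solution.
Variables m u i : fps R.
Hypotheses (xE : x = m * u) (ue : u * (1 + m + m ^+ 2) = 1) (iE : i * (1 + m) = 1).
Let e : fps R := 1 + m + m ^+ 2.
Let rho : fps R := m + i.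

(* A Groebner basis of the ideal generated by [ue] and [iE]. *)
Let um2 : u * m ^+ 2 = 1 - u - u * m.
Proof. by rewrite -ue; ring. Qed.

Let im : i * m = 1 - i.
Proof. by rewrite -iE; ring. Qed.

Let ui : u * i = i - u * m.
Proof.
apply/eqP; rewrite -subr_eq0 opprB addrA; apply/eqP.
transitivity (i * (u * (1 + m + m ^+ 2) - 1) + u * m * (1 - i * (1 + m))).
  by ring.
by rewrite ue iE !subrr !mulr0 addr0.
Qed.

Lemma count_series_up_sol h : x * count_series h true = e * rho ^+ h - 1.
Proof.
apply: subr0_eq; move: h.
pose d h := x * count_series h true - (e * rho ^+ h - 1).
apply: (fps_homogeneous_eq0 (d := d)) => h.
have closed : e * rho ^+ h - 1 =
    x * e * rho ^+ h.+1 + x * \sum_(b < h.+1) x * e * rho ^+ b.+1.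
  elim: h => [|h IH].
    by rewrite big_ord1 expr1 expr0 xE /e /rho; ring: um2 im ui.
  transitivity (x * e * rho ^+ h.+2 +
      (e * rho ^+ h - 1 - x * e * rho ^+ h.+1 + x * (x * e * rho ^+ h.+2))); last first.
    by rewrite IH [in RHS]big_ord_recr /=; ring.
  by rewrite !exprS; move: (rho ^+ h) => r; rewrite xE /e /rho; ring: um2 im ui.
rewrite /d closed {1}count_series_up.
have -> : \sum_(b < h.+1) x * (x * count_series b.+1 true - (e * rho ^+ b.+1 - 1)) =
   x * \sum_(b < h.+1) count_series b false - \sum_(b < h.+1) x * e * rho ^+ b.+1.
  rewrite mulr_sumr -sumrB; apply: eq_bigr => b _.
  by rewrite count_series_down; ring.
by ring.
Qed.

Lemma count_series_down_sol h : count_series h false = e * rho ^+ h.+1.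
Proof. by rewrite count_series_down count_series_up_sol; ring. Qed.

Let A := x * m ^+ 3 * i ^+ 2 * (2 + m) * (1 - m).
Let B := x * m ^+ 2 * i * (m ^+ 2 + 2).
Let G := e * (x * (1 + m) * (A + B) + 2 * (1 - m) ^+ 2 * (x + 2 * x ^+ 2 - 1)).
Let c := 2 * (1 - m) ^+ 2 * x ^+ 2.
Let Y (h : nat) : fps R :=
  (A * h%:R ^+ 2 + B * h%:R + G) * rho ^+ h + c * h%:R + 2 * (1 - m) ^+ 2 * (1 - x ^+ 2).

Lemma weight_series_up_sol h : c * (x * weight_series h true) = Y h.
Proof.
apply: subr0_eq; move: h.
pose d h := c * (x * weight_series h true) - Y h.
apply: (fps_homogeneous_eq0 (d := d)) => h.
pose Y' (h : nat) := x * (Y h.+1 + c * h%:R * (e * rho ^+ h.+1 - 1)).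
have closed : Y h =
    Y' h + x * \sum_(b < h.+1) (Y' b + c * b%:R * x * (e * rho ^+ b.+1)).
  elim: h => [|h IH].
    rewrite big_ord1 /= /Y' /Y expr1 expr0 /G /c /A /B xE /e /rho.
    by ring: um2 im ui.
  transitivity (Y' h.+1 +
      (Y h - Y' h + x * (Y' h.+1 + c * h.+1%:R * x * (e * rho ^+ h.+2)))); last first.
    by rewrite IH [in RHS]big_ord_recr /=; ring.
  rewrite /Y' /Y /G !exprS -!(natr1 h.+1) -!(natr1 h).
  move: (rho ^+ h) (h%:R) => r k; rewrite /c /A /B xE /e /rho.
  by ring: um2 im ui.
rewrite /d closed {1}weight_series_up.
have -> : \sum_(b < h.+1) x * (c * (x * weight_series b.+1 true) - Y b.+1) =
  c * x * \sum_(b < h.+1) (weight_series b false + b%:R * count_series b false) -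
  \sum_(b < h.+1) (Y' b + c * b%:R * x * (e * rho ^+ b.+1)).
  rewrite mulr_sumr -sumrB; apply: eq_bigr => b _.
  rewrite weight_series_down count_series_down_sol /Y' -count_series_up_sol.
  by ring.
rewrite /Y' -count_series_up_sol.
by ring.
Qed.

Definition p_series : fps R := fun n => if n is k.+1 then (p k.+1)%:R else 0.

Lemma p_seriesE : p_series = x * weight_series 0 true.
Proof.
apply/funext => -[|n]; first by rewrite fpsXM0.
by rewrite fpsXMS /p_series p_continuations.
Qed.

Hypotheses (Tu : T_series R * u * (1 - m ^+ 2) = 1) (m0 : m 0%N = 0).

Lemma p_series_T : 2 * x ^+ 4 * p_series =
  3 * x ^+ 4 * fps_geom 3 +
  (8 * x ^+ 4 + 8 * x ^+ 3 - 5 * x ^+ 2 - 3 * x + 1) * T_series R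
  - 1 + 2 * x + 5 * x ^+ 2 - x ^+ 3 - 2 * x ^+ 4.
Proof.
set t := T_series R; set g := fps_geom _.
have gE : g * (u * (1 - m) ^+ 2) = 1.
  have N3 : (fun n => 3 * g n) = 3 * g :> fps R.
    by apply/funext => n; rewrite fps_natM mulr_natl.
  have E := fps_geomP (3 : R); rewrite -/g N3 in E.
  transitivity (g * (u * (1 + m + m ^+ 2)) - 3 * (m * u) * g); first by ring.
  by rewrite ue -xE mulr1 {1}E; ring.
pose K := u * (1 - m) ^+ 2 * (1 + m).
have u0 : u 0%N = 1.
  have : (u * (1 + m + m ^+ 2)) 0%N = 1 by rewrite ue.
  by rewrite fpsM0 !fpsD expr2 fpsM0 m0 mulr0 !addr0 mulr1.
have m10 : (1 - m) 0%N = 1 by rewrite fpsD fpsN m0 fps1 subr0.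
have K0 : K 0%N = 1.
  by rewrite /K fpsM0 fpsM0 u0 expr2 fpsM0 m10 fpsD m0 fps1 addr0 !mulr1.
apply: (fps_lreg K0); apply: (@fpsXn_inj _ 2); apply: (@fps_natI 1).
apply: (@fps_lreg _ ((1 - m) ^+ 2)); first by rewrite expr2 fpsM0 m10 mulr1.
have cP : c * p_series = Y 0 by rewrite p_seriesE weight_series_up_sol.
transitivity (2 * x ^+ 4 * (c * p_series) * K); first by rewrite /c; ring.
transitivity (c * (3 * x ^+ 4 * (1 + m) * (g * (u * (1 - m) ^+ 2)) +
  (8 * x ^+ 4 + 8 * x ^+ 3 - 5 * x ^+ 2 - 3 * x + 1) * (1 - m) * (t * u * (1 - m ^+ 2))
  + (- 1 + 2 * x + 5 * x ^+ 2 - x ^+ 3 - 2 * x ^+ 4) * K)); last first.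
  by rewrite /c /K; ring.
rewrite cP gE Tu /K /Y /G /c /A /B expr0 xE /e.
by ring: um2 im ui.
Qed.

End Solution.

Lemma p_formula n : (1 <= n)%N ->
  (p n)%:R = 1 / 2 * (3 ^+ n.+1 + 8 * (T n)%:R + 8 * (T n.+1)%:R
                      - 5 * (T n.+2)%:R - 3 * (T n.+3)%:R + (T n.+4)%:R) :> R.
Proof.
case: n => // n _.
have [m [u [i [xE ue iE [Tu m0]]]]] := trinomial_parametrisation.
have := p_series_T xE ue iE Tu m0.
set t := T_series R; set g := fps_geom _ => E.
pose q : fps R := 1 - x * (2 + x * (5 - x * (1 + x * 2))).
have E' : x ^+ 4 * (2 * p_series) = x ^+ 4 * (3 * g + 8 * t) + x ^+ 3 * (8 * t)
    - x ^+ 2 * (5 * t) - x ^+ 1 * (3 * t) + t - q.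
  by rewrite mulrA [x ^+ 4 * 2]mulrC E /q; ring.
have q0 : q (4 + n.+1)%N = 0.
  rewrite /q fpsD fpsN fpsXMS fpsD fpsXMS fpsD fpsN fpsXMS fpsD fpsXMS.
  by rewrite !fpsMn !fps1 !mul0rn /= !mulr0n !(addr0, add0r, subr0, oppr0).
have X4 f : (x ^+ 4 * f) (4 + n.+1)%N = f n.+1 := fpsXnM 4 f n.+1.
have X3 f : (x ^+ 3 * f) (4 + n.+1)%N = f n.+2 := fpsXnM 3 f n.+2.
have X2 f : (x ^+ 2 * f) (4 + n.+1)%N = f n.+3 := fpsXnM 2 f n.+3.
have X1 f : (x ^+ 1 * f) (4 + n.+1)%N = f n.+4 := fpsXnM 1 f n.+4.
have := X4 (2 * p_series); rewrite E'.
rewrite !fpsD !fpsN X4 X3 X2 X1 !fpsD q0 !fps_natM subr0 /g /t /T_series /=.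
rewrite /fps_geom exprS. rewrite -[T (4 + n.+1)]/(T n.+1.+4) => F.
apply: (@mulfI _ 2); first by rewrite pnatr_eq0.
by rewrite [LHS]mulr_natl -F !exprS; field.
Qed.

End GeneratingFunctions.

(** * Asymptotics *)

Section Asymptotics.
Variable R : realType.
Local Notation t := (T_series R).

Lemma T_series_sqrE n : (t ^+ 2) n = (3 ^+ n.+1 + (- 1) ^+ n) / 4 :> R.
Proof.
pose e := (t ^+ 2 : fps R).
have eE : e = 1 + fpsX * (2 * e + fpsX * (3 * e)).
  by rewrite -{1}(T_series_sqr R) -/e; ring.
have e0 : e 0%N = 1 by rewrite eE fpsD fpsXM0 addr0.
have e1 : e 1%N = 2.
  by rewrite eE fpsD fpsXMS fpsD fpsXM0 fps_natM e0 fps1 add0r addr0.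
have eS k : e k.+2 = 2 * e k.+1 + 3 * e k.
  by rewrite {1}eE fpsD fpsXMS fpsD fpsXMS !fps_natM fps1 add0r !mulr_natl.
suff : e n = (3 ^+ n.+1 + (- 1) ^+ n) / 4 /\ e n.+1 = (3 ^+ n.+2 + (- 1) ^+ n.+1) / 4.
  by case.
elim: n => [|n [IH1 IH2]]; first by rewrite e0 e1; split; field.
by split=> //; rewrite eS IH1 IH2 !exprS; field.
Qed.

Lemma T_series_sqr_le n : (t ^+ 2) n <= 3 ^+ n.
Proof.
rewrite T_series_sqrE ler_pdivrMr // exprS.
have : (- 1) ^+ n <= 1 :> R by rewrite -signr_odd; case: odd; rewrite ?expr1 ?expr0 ?lerN1.
have : 1 <= 3 ^+ n :> R by apply: exprn_ege1; rewrite ler1n.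
lra.
Qed.

Lemma T_leX k j : (T (k + j) <= 3 ^ j * T k)%N.
Proof.
elim: j => [|j IH]; first by rewrite addn0 expn0 mul1n.
rewrite addnS expnS -mulnA (leq_trans (T_ratio _).1) //.
by rewrite leq_mul2l IH.
Qed.

Lemma T_sqr_le n : n.+1%:R * (T n)%:R ^+ 2 <= 9 ^+ n :> R.
Proof.
have le_k (k : 'I_n.+1) : (T n)%:R ^+ 2 <= 3 ^+ n * (t k * t (n - k)%N).
  have kn : (k <= n)%N by rewrite -ltnS.
  have H1 := T_leX k (n - k); have H2 := T_leX (n - k) k.
  rewrite subnKC // in H1; rewrite subnK // in H2.
  rewrite /T_series -!natrX -!natrM ler_nat expnS expn1.
  by have := leq_mul H1 H2; rewrite mulnACA -expnD subnK.
have : \sum_(k < n.+1) (T n)%:R ^+ 2 <= \sum_(k < n.+1) 3 ^+ n * (t k * t (n - k)%N).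
  by apply: ler_sum => k _; apply: le_k.
rewrite sumr_const card_ord -mulr_sumr -[_ *+ _]mulr_natl => /le_trans; apply.
rewrite (_ : 9 = 3 * 3 :> R) ?exprMn; last by ring.
apply: ler_wpM2l; first by rewrite exprn_ge0.
by rewrite -fpsM -expr2 T_series_sqr_le.
Qed.

Lemma T_negligible (eps : R) : 0 < eps -> \forall n \near \oo, (T n)%:R <= eps * 3 ^+ n.
Proof.
move=> eps0.
have eps20 : 0 < eps ^+ 2 by rewrite exprn_gt0.
near=> n.
have : `|@harmonic R n| < eps ^+ 2.
  by near: n; apply: (cvgr0_norm_lt _ (@cvg_harmonic R) _ eps20).
rewrite ger0_norm ?harmonic_ge0 // => hn.
rewrite -(@ler_pXn2r _ 2) ?nnegrE ?ler0n ?mulr_ge0 ?exprn_ge0 ?(ltW eps0) //.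
have n0 : 0 < n.+1%:R :> R by rewrite ltr0n.
rewrite -(ler_pM2l n0).
apply: (le_trans (T_sqr_le n)).
rewrite exprMn -exprM mulnC exprM (_ : 3 ^+ 2 = 9 :> R); last by ring.
rewrite mulrA ler_peMl ?exprn_ge0 //.
by rewrite -[leLHS](@mulfV _ n.+1%:R) ?pnatr_eq0 // (ler_pM2l n0) ltW.
Unshelve. all: by end_near. Qed.

Lemma p_equiv : (fun n : nat => (p n)%:R : R^o) ~_\oo
        (fun n : nat => (3 ^+ n.+1 / 2 : R^o)).
Proof.
apply/eqaddoP => eps eps0.
have d0 : 0 < eps * (3 / 239) by rewrite mulr_gt0.
near=> n.
have n1 : (1 <= n)%N by near: n; exact: nbhs_infty_ge.
have Tn : (T n)%:R <= eps * (3 / 239) * 3 ^+ n :> R.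
  by near: n; apply: T_negligible.
have le j : (T (n + j))%:R <= 3 ^+ j * (T n)%:R :> R.
  by rewrite -natrX -natrM ler_nat T_leX.
have := le 1%N; have := le 2%N; have := le 3%N; have := le 4%N.
rewrite addn1 addn2 addn3 addn4 => H4 H3 H2 H1.
rewrite /= [leLHS](_ : _ = `|1 / 2 * (8 * (T n)%:R + 8 * (T n.+1)%:R
   - 5 * (T n.+2)%:R - 3 * (T n.+3)%:R + (T n.+4)%:R)|); last first.
  by congr (`| _ |); rewrite -[LHS]/((p n)%:R - 3 ^+ n.+1 / 2) (p_formula _ n1); field.
rewrite (ger0_norm (_ : 0 <= 3 ^+ n.+1 / 2)) ?divr_ge0 ?exprn_ge0 //.
rewrite exprS ler_norml; move: H1 H2 H3 H4 Tn.
have := ler0n R (T n); have := ler0n R (T n.+1); have := ler0n R (T n.+2).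
have := ler0n R (T n.+3); have := ler0n R (T n.+4).
move: (3 ^+ n : R) => y *.
by apply/andP; split; nra.
Unshelve. all: by end_near. Qed.

End Asymptotics.

(** * Convergence of the generating function *)

Section GeneratingFunctionConvergence.
Variable R : realType.
Local Notation t := (T_series R).

Definition T_sum (x : R) (N : nat) : R := \sum_(n < N) (T n)%:R * x ^+ n.

Lemma T_sum_horner x N : T_sum x N = (trunc N t).[x].
Proof. by rewrite horner_poly. Qed.

Lemma sum_half m n : \sum_(m <= i < m + n) (2^-1 : R) ^+ i <= 2 * 2^-1 ^+ m.
Proof.
suff -> : \sum_(m <= i < m + n) (2^-1 : R) ^+ i = 2 * 2^-1 ^+ m - 2 * 2^-1 ^+ (m + n).
  by rewrite gerBl mulr_ge0 // exprn_ge0 // invr_ge0.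
elim: n => [|n IH]; first by rewrite addn0 big_geq // subrr.
by rewrite addnS big_nat_recr ?leq_addr //= IH exprS; field.
Qed.

Section SmallPoint.
Variable x : R.
Hypothesis x_small : `|x| <= 1 / 6.

Lemma norm_term_le (a : R) n : 0 <= a <= 3 ^+ n -> `|a * x ^+ n| <= 2^-1 ^+ n.
Proof.
move=> /andP[a0 an]; rewrite normrM normrX (ger0_norm a0).
apply: (@le_trans _ _ (3 ^+ n * (1 / 6) ^+ n)).
  by rewrite ler_pM // ?exprn_ge0 // lerXn2r // nnegrE.
by rewrite -exprMn (_ : 3 * (1 / 6) = 2^-1 :> R) //; field.
Qed.

Lemma T_sum_ge0 N : 0 <= T_sum x N.
Proof.
case: N => [|N]; first by rewrite /T_sum big_ord0.
rewrite /T_sum big_ord_recl T0 expr0 mulr1.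
have : `|\sum_(i < N) (T (lift ord0 i))%:R * x ^+ (lift ord0 i)| <= 1.
  apply: le_trans (ler_norm_sum _ _ _) _.
  have : \sum_(1 <= i < 1 + N) (2^-1 : R) ^+ i <= 1.
    by apply: le_trans (sum_half 1 N) _; rewrite expr1 mulfV.
  apply: le_trans.
  rewrite big_add1 /= big_mkord; apply: ler_sum => i _; rewrite /= /bump /= ?add1n.
  apply: norm_term_le; rewrite ler0n -natrX ler_nat.
  by have := T_leX 0 i.+1; rewrite T0 muln1.
by rewrite ler_norml => /andP[]; lra.
Qed.

Lemma T_sum_sqr_near N :
  `|T_sum x N ^+ 2 - \sum_(n < N) (t ^+ 2) n * x ^+ n| <= 2 * 2^-1 ^+ N.
Proof.
pose P := trunc N t * trunc N t.
have PE n : (n < N)%N -> P`_n = (t ^+ 2) n.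
  by move=> nN; rewrite /P -fps_mul_trunc.
have P_le n : 0 <= P`_n <= 3 ^+ n.
  have b k : 0 <= (trunc N t)`_k <= t k.
    by rewrite coef_poly; case: ifP; rewrite ?lexx /T_series ?ler0n.
  rewrite /P coefM; apply/andP; split.
    by apply: sumr_ge0 => i _; apply: mulr_ge0; [case/andP: (b i)|case/andP: (b (n - i)%N)].
  apply: le_trans (T_series_sqr_le R n); rewrite expr2 fpsM.
  apply: ler_sum => i _; have /andP[? ?] := b i; have /andP[? ?] := b (n - i)%N.
  by apply: ler_pM.
have sP : (size P <= N + N)%N.
  apply: leq_trans (size_polyMleq _ _) _; apply: leq_trans (leq_pred _) _.
  by apply: leq_add; apply: size_poly.
have -> : T_sum x N ^+ 2 = \sum_(n < N) (t ^+ 2) n * x ^+ n +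
    \sum_(N <= n < N + N) P`_n * x ^+ n.
  rewrite T_sum_horner expr2 -hornerM -/P (horner_coef_wide _ sP).
  rewrite -(big_mkord xpredT (fun n => P`_n * x ^+ n)) (big_cat_nat (n := N)) ?leq_addr //=.
  by congr (_ + _); rewrite big_mkord; apply: eq_bigr => i _; rewrite PE.
rewrite addrAC subrr add0r; apply: le_trans (ler_norm_sum _ _ _) _.
apply: le_trans (sum_half N N).
by apply: ler_sum => n _; apply: norm_term_le.
Qed.

Let D := 1 - 2 * x - 3 * x ^+ 2.

Let x_bounds : - (1 / 6) <= x <= 1 / 6.
Proof. by rewrite -ler_norml. Qed.

Lemma discriminant_gt0 : 0 < D.
Proof. by have /andP[] := x_bounds; rewrite /D; nra. Qed.

Lemma cvg_geom3 : \sum_(n < N) (3 * x) ^+ n @[N --> \oo] --> (1 - 3 * x)^-1.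
Proof.
have z1 : `|3 * x| < 1 by have /andP[] := x_bounds; rewrite ltr_norml; lra.
have := @cvg_geometric_series R 1 _ z1; rewrite mul1r.
rewrite (_ : series _ = fun N => \sum_(n < N) (3 * x) ^+ n) //.
apply/funext => N; rewrite /series /= big_mkord.
by apply: eq_bigr => i _; rewrite mul1r.
Qed.

Lemma cvg_T_series_sqr : \sum_(n < N) (t ^+ 2) n * x ^+ n @[N --> \oo] --> D^-1.
Proof.
have zx : `|- x| < 1 by rewrite normrN (le_lt_trans x_small) //; lra.
have E : (fun N => \sum_(n < N) (t ^+ 2) n * x ^+ n) =
    (fun N => 3 / 4 * \sum_(n < N) (3 * x) ^+ n + 1 / 4 * series (geometric 1 (- x)) N).
  apply/funext => N; rewrite /series /= big_mkord !mulr_sumr -big_split /=.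
  apply: eq_bigr => n _; rewrite T_series_sqrE mul1r exprMn exprS [(- x) ^+ n]exprNn.
  by field.
rewrite E (_ : D^-1 = 3 / 4 * (1 - 3 * x)^-1 + 1 / 4 * (1 / (1 - - x))).
  apply: cvgD; apply: cvgMr; first exact: cvg_geom3.
  exact: cvg_geometric_series.
have /andP[? ?] := x_bounds.
rewrite /D (_ : 1 - 2 * x - 3 * x ^+ 2 = (1 - 3 * x) * (1 + x)); last by ring.
by field; rewrite !gt_eqF //; lra.
Qed.

Lemma cvg_T_sum : T_sum x N @[N --> \oo] --> (Num.sqrt D)^-1.
Proof.
have sq : T_sum x N ^+ 2 @[N --> \oo] --> D^-1.
  rewrite -[D^-1]addr0.
  rewrite (_ : (fun N => T_sum x N ^+ 2) = (fun N => \sum_(n < N) (t ^+ 2) n * x ^+ n +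
    (T_sum x N ^+ 2 - \sum_(n < N) (t ^+ 2) n * x ^+ n))); last first.
    by apply/funext => N; rewrite addrC subrK.
  apply: cvgD; first exact: cvg_T_series_sqr.
  apply: norm_cvg0.
  apply: (@squeeze_cvgr _ _ _ _ (fun=> 0) (geometric 2 2^-1)).
  - by near=> N; rewrite normr_ge0 T_sum_sqr_near.
  - exact: cvg_cst.
  - by apply: cvg_geometric; rewrite ger0_norm ?invr_ge0 // invf_lt1 // ltr1n.
rewrite -sqrtrV ?(ltW discriminant_gt0) //.
rewrite (_ : T_sum x = fun N => Num.sqrt (T_sum x N ^+ 2)); last first.
  by apply/funext => N; rewrite sqrtr_sqr ger0_norm // T_sum_ge0.
by apply: continuous_cvg; [exact: sqrt_continuous|exact: sq].
Unshelve. all: by end_near. Qed.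

Lemma T_sum_shift j N : x != 0 ->
  \sum_(1 <= n < N.+1) (T (n + j))%:R * x ^+ n = (T_sum x (N.+1 + j) - T_sum x j.+1) / x ^+ j.
Proof.
move=> x0; elim: N => [|N IH]; first by rewrite big_geq // subrr mul0r.
have E : T_sum x (N.+2 + j) =
    T_sum x (N.+1 + j) + (T (N.+1 + j))%:R * x ^+ (N.+1 + j).
  by rewrite /T_sum addSn big_ord_recr.
by rewrite big_nat_recr //= IH E exprD; field; rewrite expf_neq0.
Qed.

End SmallPoint.

Lemma T2 : T 2 = 3%N. Proof. by rewrite /T !big_ord_recl big_ord0. Qed.
Lemma T3 : T 3 = 7%N. Proof. by rewrite /T !big_ord_recl big_ord0. Qed.
Lemma T4 : T 4 = 19%N. Proof. by rewrite /T !big_ord_recl big_ord0. Qed.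

Lemma cvg_p_series : \forall x \near (0 : R)^',
  (\sum_(1 <= n < N.+1) (p n)%:R * x ^+ n) @[N --> \oo] -->
    ((- 8 * x ^+ 4 - 8 * x ^+ 3 + 5 * x ^+ 2 + 3 * x - 1)
       * Num.sqrt (1 - 2 * x - 3 * x ^+ 2)
     - 6 * x ^+ 6 - 10 * x ^+ 5 + 12 * x ^+ 4 + 17 * x ^+ 3
     - 4 * x ^+ 2 - 4 * x + 1)
    / (6 * x ^+ 6 + 4 * x ^+ 5 - 2 * x ^+ 4).
Proof.
near=> x.
have x_small : `|x| <= 1 / 6 by near: x; apply: dnbhs0_le; rewrite divr_gt0.
have x0 : x != 0 by near: x; exact: nbhs_dnbhs_neq.
have D0 := discriminant_gt0 x_small.
set s := Num.sqrt _.
have s0 : s != 0 by rewrite gt_eqF // sqrtr_gt0.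
have ss : s ^+ 2 = 1 - 2 * x - 3 * x ^+ 2 by rewrite sqr_sqrtr // ltW.
pose S j N := \sum_(1 <= n < N.+1) (T (n + j))%:R * x ^+ n.
have cS j : S j N @[N --> \oo] --> (s^-1 - T_sum x j.+1) / x ^+ j.
  rewrite (_ : S j = fun N => (T_sum x (N + j.+1) - T_sum x j.+1) / x ^+ j); last first.
    by apply/funext => N; rewrite /S T_sum_shift // addSnnS.
  apply: cvgMl; apply: cvgB; last exact: cvg_cst.
  by rewrite (cvg_shiftn j.+1 (T_sum x)); apply: cvg_T_sum.
have cG : \sum_(1 <= n < N.+1) (3 * x) ^+ n @[N --> \oo] --> (1 - 3 * x)^-1 - 1.
  rewrite (_ : (fun N => _) = fun N => \sum_(n < N.+1) (3 * x) ^+ n - 1); last first.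
    by apply/funext => N; rewrite big_add1 /= big_mkord big_ord_recl expr0 addrAC subrr add0r.
  apply: cvgB; last exact: cvg_cst.
  by rewrite (cvg_shiftS (fun N => \sum_(n < N) (3 * x) ^+ n)); apply: cvg_geom3.
rewrite (_ : (fun N => _) = fun N => 1 / 2 * (3 * \sum_(1 <= n < N.+1) (3 * x) ^+ n
  + 8 * S 0 N + 8 * S 1 N - 5 * S 2 N - 3 * S 3 N + S 4 N)); last first.
  apply/funext => N; rewrite /S !mulr_sumr -!sumrN -!big_split /= -?sumrB mulr_sumr.
  apply: eq_big_nat => n /andP[n1 _].
  rewrite (p_formula R n1) addn0 addn1 addn2 addn3 addn4 exprMn exprS.
  by ring.
have -> : ((- 8 * x ^+ 4 - 8 * x ^+ 3 + 5 * x ^+ 2 + 3 * x - 1) * s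
     - 6 * x ^+ 6 - 10 * x ^+ 5 + 12 * x ^+ 4 + 17 * x ^+ 3
     - 4 * x ^+ 2 - 4 * x + 1) / (6 * x ^+ 6 + 4 * x ^+ 5 - 2 * x ^+ 4) =
  1 / 2 * (3 * ((1 - 3 * x)^-1 - 1) + 8 * ((s^-1 - T_sum x 1) / x ^+ 0)
   + 8 * ((s^-1 - T_sum x 2) / x ^+ 1) - 5 * ((s^-1 - T_sum x 3) / x ^+ 2)
   - 3 * ((s^-1 - T_sum x 4) / x ^+ 3) + (s^-1 - T_sum x 5) / x ^+ 4).
  have -> : s^-1 = s / (1 - 2 * x - 3 * x ^+ 2) by rewrite -ss; field.
  have /andP[xl xr] : - (1 / 6) <= x <= 1 / 6 by rewrite -ler_norml.
  rewrite /T_sum !big_ord_recl !big_ord0 /= /bump /= !add1n T0 T1 T2 T3 T4.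
  have -> : 6 * x ^+ 6 + 4 * x ^+ 5 - 2 * x ^+ 4 =
      - (2 * x ^+ 4 * ((1 - 3 * x) * (1 + x))) by ring.
  have -> : 1 - 2 * x - 3 * x ^+ 2 = (1 - 3 * x) * (1 + x) by ring.
  by field; rewrite x0 !gt_eqF //; lra.
apply: cvgMr.
by apply: cvgD (cS 4); apply: cvgB; [apply: cvgB; [apply: cvgD; [apply: cvgD|]|]|];
  apply: cvgMr.
Unshelve. all: by end_near. Qed.

End GeneratingFunctionConvergence.

Theorem theorem5p4 (R : realType) :
  [/\ \forall x \near (0 : R)^',
        (\sum_(1 <= n < N.+1) (p n)%:R * x ^+ n) @[N --> \oo] -->
          ((- 8 * x ^+ 4 - 8 * x ^+ 3 + 5 * x ^+ 2 + 3 * x - 1)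
             * Num.sqrt (1 - 2 * x - 3 * x ^+ 2)
           - 6 * x ^+ 6 - 10 * x ^+ 5 + 12 * x ^+ 4 + 17 * x ^+ 3
           - 4 * x ^+ 2 - 4 * x + 1)
          / (6 * x ^+ 6 + 4 * x ^+ 5 - 2 * x ^+ 4),
      forall n : nat, (1 <= n)%N ->
        (p n)%:R = 1 / 2 * (3 ^+ n.+1 + 8 * (T n)%:R + 8 * (T n.+1)%:R
                            - 5 * (T n.+2)%:R - 3 * (T n.+3)%:R
                            + (T n.+4)%:R) :> R
    & (fun n : nat => (p n)%:R : R^o) ~_\oo
        (fun n : nat => (3 ^+ n.+1 / 2 : R^o))].
Proof.
split; [exact: cvg_p_series|exact: p_formula|exact: p_equiv].
Qed.
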